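(* $\operatorname{add}(\mathcal{N})_{\mathrm{game}}^{\mathrm{I}} = \operatorname{add}(\mathcal{N})$.
   Context: $\operatorname{add}(\mathcal{N})$ is the additivity of the Lebesgue null ideal. For $k\in\omega$, $[\omega]^{k+1}$ denotes the set of subsets of $\omega$ of size $k+1$. For $\mathcal{A}\subseteq\omega^\omega$, the anti-localizing game with respect to $\mathcal{A}$: at round $k$, Player I plays $a_k\in[\omega]^{k+1}$ and then Player II plays $i_k\in\{0,1\}$. Player II wins iff $i_k=1$ for infinitely many $k$ and there is $x\in\mathcal{A}$ with $\{k: i_k=1\}=\{k: x(k)\notin a_k\}$. $\operatorname{add}(\mathcal{N})_{\mathrm{game}}^{\mathrm{I}}$ is the least $|\mathcal{A}|$ such that Player I has no winning strategy in the anti-localizing game with respect to $\mathcal{A}$. *)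

(* Defs.v *)
From mathcomp Require Import all_boot all_order all_algebra.
From mathcomp Require Import all_classical all_reals all_analysis.
Set Implicit Arguments. Unset Strict Implicit. Unset Printing Implicit Defensive.
Local Open Scope classical_set_scope.

Definition lnull (R : realType) (N : set R) : Prop :=
  (@lebesgue_measure R).-negligible N.

Definition addN_family (R : realType) (F : set (set R)) : Prop :=
  (forall N, F N -> lnull N) /\ ~ lnull (\bigcup_(N in F) N).

(* Strategies for Player I in the anti-localizing game.  Since Player I's own
   moves are determined by the strategy, a strategy is a function of the
   history of Player II's moves [i_0; ...; i_{k-1}]; at round k it must output
   a (k+1)-element subset of omega, represented as a duplicate-free list. *)
Definition strategyI : Type := seq bool -> seq nat.

Definition valid_strategyI (sigma : strategyI) : Prop :=
  forall h : seq bool, uniq (sigma h) /\ size (sigma h) = (size h).+1.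

Definition moveI (sigma : strategyI) (i : nat -> bool) (k : nat) : seq nat :=
  sigma (mkseq i k).

Definition II_wins (A : set (nat -> nat)) (sigma : strategyI)
    (i : nat -> bool) : Prop :=
  infinite_set [set k | i k] /\
  exists2 x, A x & forall k, i k = true <-> (x k \notin moveI sigma i k).

Definition winning_strategyI (A : set (nat -> nat)) (sigma : strategyI) : Prop :=
  valid_strategyI sigma /\ forall i : nat -> bool, ~ II_wins A sigma i.

Definition gameI_family (A : set (nat -> nat)) : Prop :=
  ~ exists sigma, winning_strategyI A sigma.

(* Main.v *)
Require Import Defs.
From mathcomp Require Import all_boot all_order all_algebra.
From mathcomp Require Import all_classical all_reals all_analysis.
From mathcomp Require Import measurable_realfun.
From mathcomp Require Import ring lra zify.
Set Implicit Arguments. Unset Strict Implicit. Unset Printing Implicit Defensive.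
Import Order.TTheory GRing.Theory Num.Theory.
Import numFieldNormedType.Exports.
Local Open Scope classical_set_scope.
Local Open Scope card_scope.

(** The argument is Bartoszynski's characterization of add(N) by slaloms, with
    the game inserted in the middle.  Against a winning strategy of Player I the
    run of any [x] in [A] has only finitely many ones, so [x] is eventually
    captured by one of the countably many slaloms
    [n |-> sigma (s ++ 0^n)]; conversely a slalom of width [k + 1] capturing [A]
    is a strategy that ignores the moves of Player II.

    A null set [N] is contained in the limsup of sets [C_n] that are finite
    Boolean combinations of rational intervals and have very small measure.  If
    all the code sequences of a family of null sets are captured by countably
    many slaloms, Borel-Cantelli covers the union of the family by countably
    many null sets.

    A function [f] yields the null set [H_f] of the points of [[0, 1]] lying in
    [G_(n, f n)] for infinitely many [n]; for fixed [n] the open set [G_(n, i)]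
    contains all points whose [i]-th digit in base [q = 2^(n+1)] is [0], so
    these sets behave independently.  If the union of the [H_f] is null, choose
    a compact [K] disjoint from it that has positive measure in every open set
    it meets.  By Baire category each [f] has a rational interval [V_j] meeting
    [K] such that [G_(n, f n)] misses [K] in [V_j] for all large [n];
    independence bounds the number of such values by
    [q / mu (K & V_j)], and merging over [j < n] gives a slalom of width
    [n^2 2^(n+1)].  Coding long initial segments of [f] by a single number
    lowers the width to [k + 1]. *)

(** * Slaloms and strategies *)

Lemma finite_set_nat_ltn (A : set nat) :
  finite_set A -> exists m, forall k, A k -> k < m.
Proof.
move=> /finite_seqP[s ->]; exists (\max_(i <- s) i).+1 => k /= ks.
by rewrite ltnS (@leq_bigmax_seq nat s xpredT id).
Qed.

Lemma uniq_padding (l : seq nat) (m : nat) : size l <= m ->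
  exists l', [/\ uniq l', size l' = m & {subset l <= l'}].
Proof.
move=> lm; have {lm} : size (undup l) <= m by rewrite (leq_trans (size_undup l)).
move=> /subnKC; move: (m - _) => n <- {m}; elim: n => [|n [l' [ul' sl' ll']]].
  exists (undup l); rewrite undup_uniq addn0; split => // i.
  by rewrite mem_undup.
exists ((\max_(i <- l') i).+1 :: l'); split => /=.
- rewrite ul' andbT; apply/negP => /(@leq_bigmax_seq nat _ xpredT id)/(_ isT).
  by rewrite ltnn.
- by rewrite sl' addnS.
- by move=> i /ll' il'; rewrite inE il' orbT.
Qed.

(** Otherwise every duplicate-free list in [S] of length at most [m] misses some element of [S], and
    lists grow one element at a time to length [m + 1]. *)
Lemma enum_of_bounded_uniq (S : set nat) (m : nat) :
  (forall l, uniq l -> (forall i, i \in l -> S i) -> size l <= m) ->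
  exists2 l, size l <= m & forall i, S i -> i \in l.
Proof.
move=> bS; apply: contrapT => noenum.
suff [l [ul lS sl]] :
    exists l, [/\ uniq l, forall i, i \in l -> S i & size l = m.+1].
  by have := bS l ul lS; rewrite sl ltnn.
suff H n : n <= m.+1 ->
    exists l, [/\ uniq l, forall i, i \in l -> S i & size l = n] by exact: H.
elim: n => [_|n IH nm]; first by exists [::].
have [l [ul lS sl]] := IH (ltnW nm).
have [i [Si il]] : exists i, S i /\ i \notin l.
  apply: contrapT => H; apply: noenum; exists l; first by rewrite sl.
  by move=> i Si; apply: contrapT => /negP il; apply: H; exists i.
exists (i :: l); split => /=; rewrite ?il ?sl// => j.
by rewrite inE => /orP[/eqP->//|/lS].
Qed.

(** The run against [sigma] in which Player II answers truthfully about [x]; it is the only run that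
    [x] can win. *)
Fixpoint run_history (sigma : strategyI) (x : nat -> nat) (n : nat) : seq bool :=
  if n is n'.+1 then
    rcons (run_history sigma x n') (x n' \notin sigma (run_history sigma x n'))
  else [::].

(** Truthful answers with infinitely many ones would win. Hence [s] can be a history past the last
    one, and all later histories extend it by zeros. *)
Lemma winning_run_history (A : set (nat -> nat)) (sigma : strategyI)
    (x : nat -> nat) : winning_strategyI A sigma -> A x ->
  exists s, forall n, x (size s + n) \in sigma (s ++ nseq n false).
Proof.
move=> [_ win] Ax; pose h := run_history sigma x.
pose i k := x k \notin sigma (h k).
have hE k : mkseq i k = h k by elim: k => // k IH; rewrite mkseqS IH.
have [m im] : exists m, forall k, i k -> k < m.
  apply: (@finite_set_nat_ltn [set k | i k]); apply: contrapT => inf.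
  by apply: (win i); split => //; exists x => // k; rewrite /moveI hE.
exists (h m) => n; have -> : size (h m) = m by rewrite -hE size_mkseq.
have -> : h m ++ nseq n false = h (m + n).
  elim: n => [|n IH]; first by rewrite addn0 cats0.
  rewrite -addn1 nseqD catA IH addnA addn1 /= cats1; congr rcons; apply/esym/negbTE/negP.
  by move/(im (m + n)); rewrite ltnNge leq_addr.
by apply: contrapT => /negP /(im (m + n)); rewrite ltnNge leq_addr.
Qed.

Lemma slalom_winning (A : set (nat -> nat)) (S : nat -> seq nat) :
  (forall k, size (S k) <= k.+1) ->
  (forall x, A x -> exists m, forall k, m <= k -> x k \in S k) ->
  exists sigma, winning_strategyI A sigma.
Proof.
move=> sS AS; have [f fP] := choice (fun k => @uniq_padding _ _ (sS k)).
exists (fun h => f (size h)); split.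
  by move=> h; have [? ? _] := fP (size h).
move=> i [inf [x Ax xi]]; apply: inf; have [m xm] := AS _ Ax.
apply: (sub_finite_set (B := `I_m)); last exact: finite_II.
move=> k /= ik; rewrite ltnNge; apply/negP => mk.
move/xi : ik; rewrite /moveI size_mkseq; have [_ _ sub] := fP k.
by rewrite sub// xm.
Qed.

(** * Small open sets and finite codes *)

Lemma borel_cantelli_half (R : realType) (F : nat -> set R) (e : R) :
  (0 <= e)%R -> (forall n, measurable (F n)) ->
  (forall n, lebesgue_measure (F n) <= (e / (2 ^ n.+1)%:R)%:E)%E ->
  lnull (lim_sup_set F).
Proof.
move=> e0 mF Fe.
have mL : measurable (lim_sup_set F).
  by apply: bigcapT_measurable => n; apply: bigcup_measurable.
exists (lim_sup_set F); split => //; apply: lim_sup_set_cvg0 => //.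
apply: (@le_lt_trans _ _ e%:E); last exact: ltry.
apply: le_trans (@epsilon_trick0 R e xpredT e0).
apply: lee_nneseries => [i _ _|n _]; [exact: measure_ge0|exact: Fe].
Qed.

Lemma le_measure_set (R : realType) (A B : set R) :
  measurable A -> measurable B -> A `<=` B ->
  (lebesgue_measure A <= lebesgue_measure B)%E.
Proof. by move=> mA mB AB; apply: (@le_measure _ _ _ (@lebesgue_measure R)); rewrite ?inE. Qed.

Lemma lnull_outer_open (R : realType) (N : set R) (e : R) : lnull N ->
  (0 < e)%R ->
  exists U, [/\ open U, N `<=` U & (lebesgue_measure U < e%:E)%E].
Proof.
move=> [B [mB B0 NB]] e0.
have B0' : lebesgue_measure B = 0%E by exact: B0.
have Boo : (lebesgue_measure B < +oo)%E by rewrite B0' ltry.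
have [U [oU BU Ue]] := lebesgue_regularity_outer mB Boo e0.
exists U; split => //; first exact: subset_trans BU.
rewrite (_ : lebesgue_measure U = lebesgue_measure (U `\` B)) //.
rewrite -[in LHS](setDUK BU) measureU //.
- exact: etrans (congr1 (fun z => z + _)%E B0') (add0e _).
- by apply: measurableD => //; exact: open_measurable.
- by rewrite setDE setICA setICr setI0.
Qed.

Section rational_codes.
Variable R : realType.
Implicit Types (x : R) (U : set R).
Let mu := (@lebesgue_measure R).
Local Open Scope ring_scope.

Definition in_ratitv (v : rat * rat) x : bool := ratr v.1 < x < ratr v.2.

Lemma open_ratitv v : open [set x | in_ratitv v x].
Proof.
rewrite (_ : mkset _ = `]ratr v.1, ratr v.2[%classic); first exact: itv_open.
by apply/seteqP; split => x /=; rewrite in_itv.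
Qed.

Lemma ratitv_basis U x : open U -> U x ->
  exists2 v, in_ratitv v x & forall y, in_ratitv v y -> U y.
Proof.
move=> oU Ux; have : nbhs x U by exact: open_nbhs_nbhs.
move=> /nbhs_ballP[e /= e0 eU].
have [p] : exists p : rat, ratr p \in `]x - e, x[.
  by apply: rat_in_itvoo; rewrite ltrBlDr ltrDl.
have [q] : exists q : rat, ratr q \in `]x, x + e[.
  by apply: rat_in_itvoo; rewrite ltrDl.
rewrite !in_itv /= => /andP[xq qx] /andP[xp px].
exists (p, q); rewrite /in_ratitv /= ?px// => y /andP[py yq].
apply: eU; rewrite /ball /= ltr_distlC.
by rewrite (lt_trans xp py) (lt_trans yq qx).
Qed.

Definition in_ratitvs (l : seq (rat * rat)) x : bool := has (in_ratitv^~ x) l.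

Lemma measurable_ratitvs l : measurable [set x | in_ratitvs l x].
Proof.
elim: l => [|v l IH]; first by rewrite (_ : mkset _ = set0);
  [exact: measurable0|apply/seteqP; split].
rewrite (_ : mkset _ = [set x | in_ratitv v x] `|` [set x | in_ratitvs l x]).
  by apply: measurableU => //; apply: open_measurable; exact: open_ratitv.
by apply/seteqP; split => x /= => [/orP//|[->//|H]]; rewrite /in_ratitvs/= [has _ _]H orbT.
Qed.

(* A pair [(l1, l2)] stands for the difference of the unions of [l1] and [l2]. *)
Definition code_set (c : seq (seq (rat * rat) * seq (rat * rat))) : set R :=
  [set x | has (fun p => in_ratitvs p.1 x && ~~ in_ratitvs p.2 x) c].

Lemma measurable_code_set c : measurable (code_set c).
Proof.
elim: c => [|p c IH]; first by rewrite (_ : code_set _ = set0);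
  [exact: measurable0|apply/seteqP; split].
rewrite (_ : code_set _ =
  ([set x | in_ratitvs p.1 x] `\` [set x | in_ratitvs p.2 x]) `|` code_set c).
  by apply: measurableU => //; apply: measurableD; exact: measurable_ratitvs.
apply/seteqP; split => x; rewrite /code_set/=.
  by move=> /orP[/andP[? /negP]|]; [left|right].
by move=> [[-> /negP ->]//|->]; rewrite orbT.
Qed.

Definition inner_itvs U (k : nat) : seq (rat * rat) :=
  [seq v <- pmap unpickle (iota 0 k) | `[< forall y, in_ratitv v y -> U y >]].

Lemma inner_itvs_sub U k x : in_ratitvs (inner_itvs U k) x -> U x.
Proof. by move=> /hasP[v]; rewrite mem_filter => /andP[/asboolP vU _] /vU. Qed.

Lemma inner_itvs_mono U k l x : (k <= l)%N ->
  in_ratitvs (inner_itvs U k) x -> in_ratitvs (inner_itvs U l) x.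
Proof.
move=> kl /hasP[v]; rewrite mem_filter => /andP[vU vk] vx.
apply/hasP; exists v => //; rewrite mem_filter vU /=.
move: vk; rewrite !mem_pmap => /mapP[i ik ->]; apply/mapP; exists i => //.
by move: ik; rewrite !mem_iota !add0n /= => /leq_trans; apply.
Qed.

Lemma inner_itvs_exhaust U x : open U -> U x ->
  exists k, in_ratitvs (inner_itvs U k) x.
Proof.
move=> oU Ux; have [v vx vU] := ratitv_basis oU Ux.
exists (pickle v).+1; apply/hasP; exists v => //.
rewrite mem_filter; apply/andP; split; first exact/asboolP.
rewrite mem_pmap; apply/mapP; exists (pickle v); last by rewrite pickleK.
by rewrite mem_iota /= add0n.
Qed.

Lemma inner_itvs_measure U (e : R) : open U -> (mu U < +oo)%E -> 0 < e ->
  exists K, forall k, (K <= k)%N ->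
    (mu (U `\` [set x | in_ratitvs (inner_itvs U k) x]) <= e%:E)%E.
Proof.
move=> oU Uoo e0; pose F k := U `\` [set x | in_ratitvs (inner_itvs U k) x].
have mU : measurable U by exact: open_measurable.
have mF k : measurable (F k) by apply: measurableD => //; exact: measurable_ratitvs.
have F0 : \bigcap_k F k = set0.
  apply/seteqP; split => x //= Fx; have [Ux _] := Fx 0%N I.
  by have [k] := inner_itvs_exhaust oU Ux; have [_] := Fx k I.
have Fmu0 : mu \o F @ \oo --> (0%E : \bar R).
  have <- : mu (\bigcap_n F n) = 0%E by rewrite F0; exact: measure0.
  apply: nonincreasing_cvg_mu => //.
  - by apply: le_lt_trans Uoo; apply: le_measure_set (mF 0%N) mU _ => x [].
  - by rewrite F0; exact: measurable0.
  - move=> k l kl; apply/subsetPset => x [Ux nx]; split => //= H; apply: nx.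
    exact: inner_itvs_mono H.
have /Fmu0 [K _ HK] : nbhs (0%E : \bar R) [set y | (y < e%:E)%E].
  by apply: open_nbhs_nbhs; split; [exact: open_ereal_lt_ereal|rewrite /= lte_fin].
by exists K => k /HK /ltW.
Qed.
End rational_codes.

(** * From null sets to functions *)

Lemma measure_le_cover (R : realType) (A : set R) (F : nat -> set R) (n : nat)
    (e : R) :
  measurable A -> (forall i, (i < n)%N -> measurable (F i)) ->
  (forall i, (i < n)%N -> (lebesgue_measure (F i) <= e%:E)%E) ->
  (forall x, A x -> exists2 i, (i < n)%N & F i x) ->
  (lebesgue_measure A <= (n%:R * e)%:E)%E.
Proof.
move=> mA mF Fe AF.
apply: (@le_trans _ _ (\sum_(i < n) lebesgue_measure (F i))%E).
  apply: (content_subadditive (@lebesgue_measure R)) => // x /AF[i ni Fix].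
  by rewrite -bigcup_mkord; exists i.
apply: (@le_trans _ _ (\sum_(i < n) e%:E)%E).
  by apply: lee_sum => i _; exact: Fe.
by rewrite sumEFin sumr_const card_ord lee_fin mulr_natl.
Qed.

Section null_codes.
Variable R : realType.
Local Open Scope ring_scope.
Let mu := (@lebesgue_measure R).

(** The factor [1 / (n + 1)] pays for the [n + 1] candidates in a move of Player I; the remaining
    [2^-(n+1)] is summable. *)
Definition code_bound (n : nat) : R := (2 ^ n.+1)%:R^-1 / n.+1%:R.

Lemma null_set_code (N : set R) : lnull N ->
  exists2 c, N `<=` lim_sup_set (fun n => @code_set R (c n)) &
    forall n, (mu (@code_set R (c n)) <= (code_bound n)%:E)%E.
Proof.
(* The set coded by [c n] will be covered by [n + 1] pieces of measure at most [e n]. *)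
move=> N0; pose e n := code_bound n / n.+1%:R.
have e0 n : 0 < e n by rewrite !divr_gt0// ?invr_gt0 ltr0n ?expn_gt0.
have [U UP] := choice (fun n => lnull_outer_open N0 (e0 n)).
have oU n : open (U n) by have [] := UP n.
have NU n : N `<=` U n by have [] := UP n.
have mU n : measurable (U n) by exact: open_measurable.
have Ue n : (mu (U n) <= (e n)%:E)%E by have [_ _ /ltW] := UP n.
have Uoo n : (mu (U n) < +oo)%E by apply: le_lt_trans (Ue n) _; exact: ltry.
have [K KP] := choice (fun p : nat * nat =>
  inner_itvs_measure (oU p.1) (Uoo p.1) (e0 p.2)).
(* The maximum makes stage [n] accurate for all [U m] with [m <= n]; the summand [n] makes the
   stages exhaust each [U m]. *)
pose k n := (\max_(m < n.+1) K (val m, n) + n)%N.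
have kK m n : (m < n.+1)%N -> (K (m, n) <= k n)%N.
  move=> mn; apply: leq_trans (leq_addr _ _).
  exact: (@leq_bigmax _ (fun m : 'I_n.+1 => K (val m, n)) (Ordinal mn)).
pose I m j := inner_itvs (U m) (k j).
(* [c n] adds, for each [m <= n], the part of [U m] approximated between stages
   [n] and [n.+1], and all of it when [m = n]: for every [m], a point of [U m]
   enters some [c n] with [n >= m]. *)
pose c n := [seq (I m n.+1, if (m < n)%N then I m n else [::]) | m <- iota 0 n.+1].
have cP n x : @code_set R (c n) x <-> exists m, [/\ (m < n.+1)%N,
    in_ratitvs (I m n.+1) x & (m < n)%N -> ~ in_ratitvs (I m n) x].
  rewrite /code_set /mkset has_map; split.
    move=> /hasP[m]; rewrite mem_iota add0n => mn /andP[/= H1 H2].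
    by exists m; split => // mn'; move: H2; rewrite mn' => /negP.
  move=> [m [mn H1 H2]]; apply/hasP; exists m; first by rewrite mem_iota add0n.
  by rewrite /= H1 /=; case: ifP => // /H2 /negP.
exists c => [x Nx p _|n].
  have [k0 xk0] := inner_itvs_exhaust (oU p) (NU p x Nx).
  have : exists j, (p <= j)%N && in_ratitvs (I p j.+1) x.
    exists (maxn p k0); rewrite leq_maxl /=; apply: inner_itvs_mono xk0.
    by rewrite (leq_trans _ (leq_addl _ _))// (leq_trans _ (leqnSn _))// leq_maxr.
  move=> /ex_minnP[j /andP[pj xj] jmin]; exists j => //=.
  apply/cP; exists p; split => //; case: j pj xj jmin => // j pj xj jmin.
  by rewrite ltnS => pj' xI; have := jmin j; rewrite pj' xI ltnn => /(_ isT).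
have -> : code_bound n = n.+1%:R * e n by rewrite mulrC divfK ?pnatr_eq0.
pose F m := if (m < n)%N then U m `\` [set x | in_ratitvs (I m n) x] else U m.
apply: (measure_le_cover (F := F)).
- exact: measurable_code_set.
- move=> i _; rewrite /F; case: ifP => // _.
  by apply: measurableD => //; exact: measurable_ratitvs.
- move=> i ni; rewrite /F; case: ifPn => [_|]; first exact/(KP (i, n))/kK.
  rewrite -leqNgt => ni'; have -> : i = n by apply/eqP; rewrite eqn_leq ni' -ltnS ni.
  exact: Ue.
- move=> x /cP[m [mn xm nx]]; exists m => //; rewrite /F.
  by case: ifPn => [/nx|_]; [split => //|]; exact: inner_itvs_sub xm.
Qed.

Definition decode_set (i : nat) : set R := @code_set R (odflt [::] (unpickle i)).

Lemma game_family_of_addN (F : set (set R)) : addN_family F ->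
  exists2 A : set (nat -> nat), gameI_family A & A #<= F.
Proof.
move=> [F0 Fbig].
have /choice[x xP] : forall N : set R, exists x : nat -> nat, lnull N ->
    N `<=` lim_sup_set (fun n => decode_set (x n)) /\
    forall n, (mu (decode_set (x n)) <= (code_bound n)%:E)%E.
  move=> N; have [N0|?] := pselect (lnull N); last by exists id.
  have [c Nc cmu] := null_set_code N0.
  exists (fun n => pickle (c n)) => _.
  have dE n : decode_set (pickle (c n)) = code_set (c n) by rewrite /decode_set pickleK.
  by split => [|n]; [rewrite (funext dE)|rewrite dE].
exists [set x N | N in F]; last exact: card_image_le.
move=> [sigma win]; apply: Fbig; have [valid _] := win.
pose h s n := s ++ nseq n false.
have sh s n : size (h s n) = (size s + n)%N by rewrite size_cat size_nseq.
(* Player I may list codes of large sets; [G] keeps only the entries obeying the bound, which the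
   true code satisfies. *)
pose G s n i := i \in sigma (h s n) /\
  (mu (decode_set i) <= (code_bound (size s + n))%:E)%E.
pose B s n := \bigcup_(i in [set i | G s n i]) decode_set i.
have mD i : measurable (decode_set i) by exact: measurable_code_set.
have B0 s : lnull (lim_sup_set (B s)).
  apply: (@borel_cantelli_half R _ 1) => // n.
    by apply: bigcup_measurable => i _; exact: mD.
  pose l := sigma (h s n).
  have sl : size l = (size s + n).+1 by have [_] := valid (h s n); rewrite sh.
  pose H j := if `[< G s n (nth 0%N l j) >] then decode_set (nth 0%N l j) else set0.
  apply: (@le_trans _ _ ((size s + n).+1%:R * code_bound (size s + n))%:E).
    apply: (measure_le_cover (F := H)).
    - by apply: bigcup_measurable => i _; exact: mD.
    - by move=> i _; rewrite /H; case: ifP => // _; exact: measurable0.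
    - move=> i _; rewrite /H; case: ifPn => [/asboolP[]//|_].
      rewrite measure0 lee_fin divr_ge0// invr_ge0 ler0n.
    - move=> y [i [/= il imu] iy]; exists (index i l); first by rewrite -sl index_mem.
      by rewrite /H nth_index//; case: ifPn => // /asboolP; case.
  rewrite lee_fin /code_bound mulrC divfK ?pnatr_eq0// mul1r lef_pV2 ?posrE ?ltr0n ?expn_gt0//.
  by rewrite ler_nat leq_exp2l// ltnS leq_addl.
apply: negligibleS (negligible_bigcup (fun k => B0 (odflt [::] (unpickle k)))).
move=> y [N FN Ny].
have [Nx xmu] := xP N (F0 N FN).
have [s sP] := winning_run_history win (imageP x FN).
exists (pickle s) => //; rewrite pickleK /= => p _.
have [j /= pj yj] := Nx y Ny (size s + p)%N I.
exists (j - size s)%N.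
  by rewrite /= leq_subRL// (leq_trans _ pj)// leq_addr.
have sj : (size s <= j)%N by rewrite (leq_trans _ pj)// leq_addr.
exists (x N j) => //; split; first by rewrite -[X in x N X](subnKC sj); exact: sP.
by rewrite subnKC.
Qed.
End null_codes.

(** * Neighbourhoods of the grid [q^-i Z] *)

(** With [q = p + 1] this reads [(1 - 1/q)^s <= q / s], the decay used for [s] independent
    digits. *)
Lemma mul_expn_leq (p s : nat) : (s * p ^ s <= p.+1 ^ s.+1)%N.
Proof.
elim: s => [|s IH]; first by rewrite mul0n.
rewrite mulSn expnS mulnCA [X in (_ <= X)%N]expnS mulSn leq_add//.
  by rewrite -expnS leq_exp2r.
by rewrite leq_mul2l IH orbT.
Qed.

(* The sieve lists the [m < q^B] none of whose base-[q] digits at a position in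
   [l] is zero, position [0] being the most significant one. *)
Fixpoint sieve (q : nat) (l : seq nat) (B : nat) : seq nat :=
  if B is B'.+1 then
    [seq (m * q + r)%N | m <- sieve q l B',
                         r <- if B' \in l then iota 1 q.-1 else iota 0 q]
  else [:: 0%N].

Lemma count_ltnS (l : seq nat) (B : nat) : uniq l ->
  count (fun b => (b < B.+1)%N) l = (count (fun b => (b < B)%N) l + (B \in l))%N.
Proof.
move=> ul; rewrite -(count_uniq_mem _ ul) -count_predUI.
rewrite [X in (_ + X)%N](_ : _ = 0%N) ?addn0; last first.
  apply/eqP; rewrite -leqn0 leqNgt -has_count; apply/hasPn => b _ /=.
  by apply/negP => /andP[bB /eqP bE]; rewrite bE ltnn in bB.
by apply: eq_count => b /=; rewrite ltnS leq_eqVlt orbC.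
Qed.

(** The density [(1 - 1/q)^s] cleared of denominators: each position of [l] below [B] forbids one
    digit out of [q]. *)
Lemma size_sieve (q : nat) (l : seq nat) (B : nat) : uniq l ->
  let s := count (fun b => (b < B)%N) l in
  (size (sieve q l B) * q ^ s = q ^ B * q.-1 ^ s)%N.
Proof.
move=> ul /=; elim: B => [|B IH].
  by rewrite (eq_count (a2 := pred0)) ?count_pred0//.
rewrite count_ltnS//= size_allpairs; case: ifP => _; rewrite size_iota.
  by rewrite addn1 !expnS; nia.
by rewrite addn0 expnS; nia.
Qed.

Section grid.
Variable R : realType.
Local Open Scope ring_scope.
Let mu := (@lebesgue_measure R).

(* The radius is twice the length of a cell of the next grid, so that every
   closed cell with [i]-th digit [0] is contained in the neighbourhood. *)
Definition grid_nbhd (q i : nat) : set R :=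
  \bigcup_m ball (m%:R / (q ^ i)%:R : R) (2 / (q ^ i.+1)%:R).

Lemma open_grid_nbhd q i : open (grid_nbhd q i).
Proof. by apply: bigcup_open => m _; exact: ball_open. Qed.

(** Since [q >= 2], the radius is at most one grid step, so only the balls with [m <= q^i] meet
    [[0, 1]]; each has length [4 / q^(i+1)]. *)
Lemma grid_nbhd_measure q i : (1 < q)%N ->
  (mu (`[0%R, 1%R] `&` grid_nbhd q i) <= (8 / q%:R)%:E)%E.
Proof.
move=> q1; have q0 : 0 < q%:R :> R by rewrite ltr0n ltnW.
have qi0 : 1 <= (q ^ i)%:R :> R by rewrite ler1n expn_gt0 ltnW.
have q2 : 2 <= q%:R :> R by rewrite ler_nat.
pose F m := ball (m%:R / (q ^ i)%:R : R) (2 / (q ^ i.+1)%:R).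
apply: (@le_trans _ _ ((q ^ i).+1%:R * (4 / (q ^ i.+1)%:R))%:E); last first.
  rewrite lee_fin expnS natrM -natr1 mulrA ler_pdivrMr ?mulr_gt0//; last lra.
  rewrite [X in _ <= X](_ : _ = 8 * (q ^ i)%:R); first lra.
  by field; rewrite gt_eqF.
apply: (measure_le_cover (F := F)).
- apply: measurableI; first exact: measurable_itv.
  by apply: open_measurable; exact: open_grid_nbhd.
- by move=> m _; apply: open_measurable; exact: ball_open.
- move=> m _; rewrite lebesgue_measure_ball ?divr_ge0//.
  by rewrite lee_fin -mulr_natr; lra.
- move=> x [/=]; rewrite in_itv/= => /andP[x0 x1] [m _ mx]; exists m => //.
  move: mx; rewrite /ball/= => /ltr_normlW.
  rewrite ltrBlDl ltr_pdivrMr; last lra.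
  rewrite mulrDl expnS natrM [X in _ < _ + X](_ : _ = 2 / q%:R); last first.
    by field; rewrite !gt_eqF//; lra.
  move=> mx; rewrite -(ltr_nat R) -natr1 (lt_le_trans mx)//; apply: lerD.
    by rewrite ler_piMl//; lra.
  by rewrite ler_pdivrMr// mul1r.
Qed.

(** Cells are closed on both sides so that the right end point also receives a digit. *)
Lemma bracket_nat (q : nat) (t : R) : 0 <= t -> t <= q.+1%:R ->
  exists2 r, (r < q.+1)%N & r%:R <= t <= r%:R + 1.
Proof.
elim: q => [|q IH] t0 tq; first by exists 0%N; rewrite // add0r t0.
have [/(IH t0)[r rq rt]|/ltW qt] := leP t q.+1%:R; first by exists r; rewrite // ltnW.
by exists q.+1; rewrite // qt natr1.
Qed.

Lemma sieve_cover q l B (x : R) : (1 < q)%N -> 0 <= x <= 1 ->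
  (forall b, b \in l -> ~ grid_nbhd q b x) ->
  exists2 m, m \in sieve q l B & m%:R <= x * (q ^ B)%:R <= m%:R + 1.
Proof.
move=> q1 /andP[x0 x1] xl; have q0 : 0 < q%:R :> R by rewrite ltr0n ltnW.
elim: B => [|B [m mS /andP[m1 m2]]].
  by exists 0%N; rewrite ?inE// expn0 mulr1 add0r x0.
have qB0 : 0 < (q ^ B)%:R :> R by rewrite ltr0n expn_gt0 ltnW.
pose t := x * (q ^ B.+1)%:R - (m * q)%:R.
have tE : t = (x * (q ^ B)%:R - m%:R) * q%:R by rewrite /t expnS !natrM; ring.
have q1E : q.-1.+1 = q by rewrite prednK// ltnW.
have [||r rq /andP[r1 r2]] := @bracket_nat q.-1 t.
- by rewrite tE mulr_ge0// subr_ge0.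
- have h : x * (q ^ B)%:R - m%:R <= 1 by rewrite lerBlDl.
  by rewrite tE q1E ler_piMl// ltW.
rewrite q1E in rq; exists (m * q + r)%N; last first.
  have -> : x * (q ^ B.+1)%:R = (m * q)%:R + t by rewrite addrC subrK.
  by rewrite natrD -addrA !lerD2l r1.
apply: allpairs_f => //; case: ifPn => [Bl|_]; rewrite mem_iota; last by rewrite add0n.
(* Digit [0] would put [x] within [1 / q^(B+1)] of [m / q^B], hence inside [grid_nbhd q B]. *)
rewrite add1n q1E rq andbT lt0n; apply/negP => /eqP r0.
apply: (xl B Bl); exists m => //; rewrite /ball/= distrC.
rewrite ltr_pdivlMr ?ltr0n ?expn_gt0 ?(ltnW q1)// -[X in _ * X](@ger0_norm R)//.
rewrite -normrM (_ : _ * _ = t); last first.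
  by rewrite /t expnS !natrM; field; rewrite gt_eqF.
by move: r1 r2; rewrite r0 => ? ?; rewrite ger0_norm//; lra.
Qed.

(** [Y] is covered by the cells surviving the sieve, whose total length is [(1 - 1/q)^s] once [B]
    exceeds all positions in [l]. *)
Lemma grid_avoiding_bound q (Y : set R) (l : seq nat) (c : R) : (1 < q)%N ->
  measurable Y -> Y `<=` `[0, 1] -> (c%:E <= mu Y)%E -> uniq l ->
  (forall b, b \in l -> Y `&` grid_nbhd q b = set0) ->
  (size l)%:R * c <= q%:R.
Proof.
move=> q1 mY Y01 cY ul lY; have q0 : 0 < q%:R :> R by rewrite ltr0n ltnW.
pose B := (\max_(b <- l) b).+1; pose s := size l.
have sE : count (fun b => (b < B)%N) l = s.
  apply/eqP; rewrite -all_count; apply/allP => b bl.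
  by rewrite ltnS (@leq_bigmax_seq nat l xpredT id).
have := size_sieve q B ul; rewrite /= sE => szE.
have qs0 : 0 < (q ^ s)%:R :> R by rewrite ltr0n expn_gt0 ltnW.
have qB0 : 0 < (q ^ B)%:R :> R by rewrite ltr0n expn_gt0 ltnW.
pose L := sieve q l B.
pose F i := `[(nth 0%N L i)%:R / (q ^ B)%:R, ((nth 0%N L i)%:R + 1) / (q ^ B)%:R]%classic : set R.
have YF : (mu Y <= ((size L)%:R * (q ^ B)%:R^-1)%:E)%E.
  apply: (measure_le_cover (F := F)) => //.
  - by move=> i _; exact: measurable_itv.
  - move=> i _; rewrite lebesgue_measure_itv /= lte_fin ltr_pM2r ?invr_gt0// ltrDl ltr01.
    by rewrite -EFinD lee_fin mulrDl mul1r addrAC subrr add0r.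
  - move=> x Yx; have := Y01 x Yx; rewrite /= in_itv/= => x01.
    have [|m mL mx] := @sieve_cover q l B x q1 x01.
      by move=> b bl xb; have : (Y `&` grid_nbhd q b) x by []; rewrite lY.
    exists (index m L); first by rewrite index_mem.
    by rewrite /F /= nth_index// in_itv/= ler_pdivrMr// ler_pdivlMr.
have := le_trans cY YF; rewrite lee_fin => cL.
have : c * (q ^ s)%:R <= (q.-1 ^ s)%:R.
  have -> : (q.-1 ^ s)%:R = (size L)%:R / (q ^ B)%:R * (q ^ s)%:R :> R.
    rewrite mulrAC -natrM szE natrM mulrAC mulfV ?mul1r// gt_eqF//.
  by rewrite ler_pM2r.
move=> cs; rewrite -(ler_pM2r qs0) -mulrA -natrM -expnS.
have := mul_expn_leq q.-1 s; rewrite prednK ?(ltnW q1)// -(ler_nat R) natrM.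
by apply: le_trans; rewrite ler_wpM2l.
Qed.
End grid.

(** * Baire category in a closed set *)

Section baire.
Variable R : realType.
Local Open Scope ring_scope.

Lemma cluster_closed (T : topologicalType) (F : set_system T) (C : set T) x :
  closed C -> F C -> cluster F x -> C x.
Proof. by move=> cC FC Fx; apply: cC => B Bx; exact: Fx. Qed.

(** Build nested closed intervals centred in [K], the one after step [m] inside [O m]. By
    compactness the centres have a cluster point, which lies in [K] and in every interval. *)
Lemma baire_closed_subset (K : set R) (O : nat -> set R) :
  closed K -> K !=set0 -> (forall m, open (O m)) ->
  (forall m x e, K x -> 0 < e -> exists y, [/\ K y, `|x - y| < e & O m y]) ->
  exists2 y, K y & forall m, O m y.
Proof.
move=> cK [x0 Kx0] oO dO.
pose good (s : R * R) := K s.1 /\ 0 < s.2.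
have /choice[next nextP] : forall p : nat * (R * R), exists s' : R * R,
    good p.2 -> good s' /\ (forall y, `|s'.1 - y| <= s'.2 ->
      `|p.2.1 - y| <= p.2.2 /\ O p.1 y).
  move=> [m [x e]]; have [[/= Kx e0]|ng] := pselect (good (x, e)); last first.
    by exists (x, e) => /ng.
  have [y [Ky xy Oy]] := dO m x e Kx e0.
  have : nbhs y (ball x e `&` O m).
    apply: open_nbhs_nbhs; split; last by split.
    by apply: openI; [exact: ball_open|exact: oO].
  move=> /nbhs_ballP[d /= d0 dP]; exists (y, d / 2) => _; split=> [|z /= yz].
    by split; rewrite //= divr_gt0.
  have /dP[xz Oz] : ball y d z by rewrite /ball/= (le_lt_trans yz)// ltr_pdivrMr// ltr_pMr// ltr1n.
  by split => //; exact: ltW.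
pose s := fix s n := if n is n'.+1 then next (n', s n') else (x0, 1).
have gs n : good (s n) by elim: n => [|n IH]; [|exact: (nextP (n, s n) IH).1].
have sS n y : `|(s n.+1).1 - y| <= (s n.+1).2 ->
    `|(s n).1 - y| <= (s n).2 /\ O n y by exact: (nextP (n, s n) (gs n)).2.
pose D n := `[(s n).1 - (s n).2, (s n).1 + (s n).2]%classic.
have DE n y : D n y <-> `|(s n).1 - y| <= (s n).2.
  by rewrite /D /= in_itv/= ler_distlC.
have sD n k : D n (s (n + k)%N).1.
  elim: k n => [|k IH] n.
    by rewrite addn0; apply/DE; rewrite subrr normr0 ltW//; have [] := gs n.
  by rewrite addnS -addSn; apply/DE; apply: (sS _ _ _).1; apply/DE; exact: IH.
pose F := (fun k => (s k).1) @ \oo.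
have FD n : F (D n) by exists n => // k /= nk; rewrite -(subnKC nk); exact: sD.
have [l [_ lF]] := segment_compact (fmap_proper_filter _ _) (FD 0%N).
have lD n : D n l by apply: (cluster_closed _ (FD n) lF); exact: itv_closed.
exists l => [|m]; last by apply: (sS m l _).2; apply/DE.
by apply: cluster_closed lF => //; exists 0%N => // k _; have [] := gs k.
Qed.
End baire.

(** * From functions to null sets *)

Lemma width_leq (n : nat) : (n * (n * 2 ^ n.+1) <= 2 ^ (4 * n))%N.
Proof.
case: n => [//|n]; have n2 := ltnW (@ltn_expl 2 n.+1 isT).
rewrite (_ : 4 * n.+1 = n.+1 + (n.+1 + (n.+1 + n.+1)))%N; last by lia.
rewrite [X in (_ <= X)%N]expnD leq_mul// [X in (_ <= X)%N]expnD leq_mul//.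
by rewrite leq_exp2l//; lia.
Qed.

Section slalom_of_null_set.
Variable R : realType.
Local Open Scope ring_scope.
Let mu := (@lebesgue_measure R).

Definition grid_limsup (f : nat -> nat) : set R :=
  lim_sup_set (fun n => `[0, 1] `&` @grid_nbhd R (2 ^ n.+1) (f n)).

Lemma lnull_grid_limsup f : lnull (grid_limsup f).
Proof.
apply: (@borel_cantelli_half R _ 8) => // n.
  apply: measurableI; first exact: measurable_itv.
  by apply: open_measurable; exact: open_grid_nbhd.
by apply: grid_nbhd_measure; rewrite -{1}(expn0 2) ltn_exp2l.
Qed.

Definition ratitv_nth (j : nat) : set R :=
  [set x | if unpickle j is Some v then in_ratitv v x else false].

Lemma open_ratitv_nth j : open (ratitv_nth j).
Proof.
rewrite /ratitv_nth; case: (unpickle j) => [v|]; first exact: open_ratitv.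
rewrite (_ : mkset _ = set0); first exact: open0.
by apply/seteqP; split.
Qed.

Lemma ratitv_nth_basis (U : set R) x : open U -> U x ->
  exists2 j, ratitv_nth j x & ratitv_nth j `<=` U.
Proof.
move=> oU Ux; have [v vx vU] := ratitv_basis oU Ux.
by exists (pickle v); rewrite /ratitv_nth /= pickleK.
Qed.

(** Remove from [[0, 1]] an open cover [U] of [W] of measure below [1], then each rational interval
    meeting the rest in a null set. The second removal costs only the null set [Z]. *)
Lemma positive_measure_core (W : set R) : lnull W -> exists K : set R,
  [/\ closed K, K `<=` `[0, 1], K !=set0, K `&` W = set0 &
    forall j, K `&` ratitv_nth j !=set0 -> (0 < mu (K `&` ratitv_nth j))%E].
Proof.
move=> W0; have [U [oU WU U1]] := lnull_outer_open W0 (@ltr01 R).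
pose V := ratitv_nth; have mV j : measurable (V j).
  by apply: open_measurable; exact: open_ratitv_nth.
have mU : measurable U by exact: open_measurable.
have m01 : measurable (`[0, 1]%classic : set R) by exact: measurable_itv.
pose X j := (V j `&` `[0, 1]) `\` U.
have mX j : measurable (X j) by apply: measurableD => //; exact: measurableI.
pose bad := [set j | mu (X j) = 0%E].
pose Z := \bigcup_(j in bad) X j.
have mZ : measurable Z by apply: bigcup_measurable => j _; exact: mX.
have Z0 : mu Z = 0%E.
  apply/eqP; rewrite -measure_le0.
  pose Y j := if `[< bad j >] then X j else set0.
  have Y0 j : mu (Y j) = 0%E.
    by rewrite /Y; case: ifPn => [/asboolP//|_]; exact: measure0.
  have mY j : measurable (Y j).
    by rewrite /Y; case: ifPn => // _; exact: measurable0.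
  rewrite (_ : 0%E = \sum_(0 <= j <oo) mu (Y j))%E; last by rewrite eseries0.
  apply: (measure_sigma_subadditive (@lebesgue_measure R)) => //.
  by move=> x [j bj Xjx]; exists j => //; rewrite /Y asboolT.
pose K := `[0, 1] `\` (U `|` \bigcup_(j in bad) V j).
have cK : closed K.
  rewrite /K setDE; apply: closedI; first exact: itv_closed.
  by apply: open_closedC; apply: openU => //; apply: bigcup_open => j _; exact: open_ratitv_nth.
have mK : measurable K by exact: closed_measurable.
have K01 : K `<=` `[0, 1] by move=> x [].
exists K; split => //.
- apply/set0P/negP => /eqP K0.
  suff : (mu `[0%R, 1%R] < 1)%E.
    by rewrite /mu lebesgue_measure_itv /= lte_fin ltr01 sube0 ltxx.
  apply: (@le_lt_trans _ _ (mu (U `|` Z))).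
    apply: le_measure_set => //; first exact: measurableU.
    move=> x x01; have [Ux|nUx] := pselect (U x); [by left|right].
    have : ~ K x by rewrite K0.
    move=> /not_andP[//|/contrapT[//|[j bj Vx]]].
    by exists j.
  apply: (@le_lt_trans _ _ (mu U + mu Z)%E); first exact: measureU2.
  by rewrite Z0 adde0.
- by apply/seteqP; split => x //= [[_ nU] /WU Ux]; apply: nU; left.
- move=> j [x [Kx Vx]]; have mKV : measurable (K `&` V j) by exact: measurableI.
  have nb : ~ bad j by case: Kx => _ nb bj; apply: nb; right; exists j.
  rewrite lt0e measure_ge0 andbT; apply/eqP => KV0; apply: nb.
  apply/eqP; rewrite -measure_le0.
  apply: (@le_trans _ _ (mu ((K `&` V j) `|` Z))); last first.
    apply: (@le_trans _ _ (mu (K `&` V j) + mu Z)%E); first exact: measureU2.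
    by rewrite Z0 adde0 [X in (X <= _)%E]KV0.
  apply: le_measure_set => //; first exact: measurableU.
  move=> y [[Vy y01] nU]; have [[i bi Vi]|nV] := pselect ((\bigcup_(i in bad) V i) y).
    by right; exists i.
  by left; split => //; split => // -[].
Qed.

Lemma slalom_of_lnull (W : set R) : lnull W -> exists S : nat -> seq nat,
  (forall n, (size (S n) <= n * (n * 2 ^ n.+1))%N) /\
  forall f, grid_limsup f `<=` W -> exists m, forall n, (m <= n)%N -> f n \in S n.
Proof.
move=> /positive_measure_core[K [cK K01 K0 KW Kpos]].
pose avoid j n i := (K `&` ratitv_nth j) `&` @grid_nbhd R (2 ^ n.+1) i = set0.
(* [T (j, n)] lists the avoided values when few enough, and defaults to [[::]], so that the width
   bound always holds. *)
have /choice[T TP] : forall p : nat * nat, exists l : seq nat,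
    (size l <= p.2 * 2 ^ p.2.+1)%N /\
    ((exists2 l', (size l' <= p.2 * 2 ^ p.2.+1)%N &
       forall i, avoid p.1 p.2 i -> i \in l') ->
     forall i, avoid p.1 p.2 i -> i \in l).
  move=> [j n] /=; have [[l sl lP]|nl] := pselect (exists2 l',
    (size l' <= n * 2 ^ n.+1)%N & forall i, avoid j n i -> i \in l').
  - by exists l.
  - by exists [::].
exists (fun n => flatten [seq T (j, n) | j <- iota 0 n]); split => [n|f fW].
  rewrite size_flatten /shape -map_comp sumnE big_map.
  apply: (@leq_trans (\sum_(j <- iota 0 n) n * 2 ^ n.+1)%N).
    by apply: leq_sum => j _; exact: (TP (j, n)).1.
  by rewrite big_const_seq count_predT size_iota iter_addn_0 mulnC.
have [j [m [Kj jm]]] : exists j m, K `&` ratitv_nth j !=set0 /\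
    forall n, (m <= n)%N -> avoid j n (f n).
  (* Otherwise each [O m] is dense in [K], and Baire yields a point of [K] in [grid_limsup f], hence
     in [W]. *)
  apply: contrapT => nex.
  pose O m := \bigcup_(n in [set n | (m <= n)%N]) @grid_nbhd R (2 ^ n.+1) (f n).
  have [|m x e Kx e0|y Ky yO] := @baire_closed_subset R K O cK K0.
  - by move=> m; apply: bigcup_open => n _; exact: open_grid_nbhd.
  - have [j jx je] := ratitv_nth_basis (ball_open x e) (ballxx x e0).
    apply: contrapT => ny; apply: nex; exists j, m; split; first by exists x.
    move=> n mn; apply/seteqP; split => // y [[Ky jy] gy]; apply: ny.
    by exists y; split => //; [exact: je|exists n].
  - have : (K `&` W) y; last by rewrite KW.
    split => //; apply: fW => p _; have [n pn gn] := yO p; exists n => //.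
    by split => //; exact: K01.
have [c c0 cK'] : exists2 c : R, 0 < c & (c%:E <= mu (K `&` ratitv_nth j))%E.
  move: (Kpos j Kj); case: (mu _) => [r| |]//.
    by rewrite lte_fin => r0; exists r.
  by move=> _; exists 1 => //; exact: leey.
(* For [n >= N] one has [n * c >= 1], which turns [size l * c <= q] into [size l <= n * q]. *)
pose N := Num.bound c^-1.
exists (maxn m (maxn j.+1 N)) => n; rewrite !geq_max => /and3P[mn jn Nn].
apply/flattenP; exists (T (j, n)); first by apply: map_f; rewrite mem_iota add0n.
apply: (TP (j, n)).2; last exact: jm.
apply: (@enum_of_bounded_uniq (avoid j n)) => l ul lP.
have q1 : (1 < 2 ^ n.+1)%N by rewrite -{1}(expn0 2) ltn_exp2l.
have mY : measurable (K `&` ratitv_nth j).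
  apply: measurableI; first exact: closed_measurable.
  by apply: open_measurable; exact: open_ratitv_nth.
have Y01 : K `&` ratitv_nth j `<=` `[0, 1] by move=> x [/K01].
have lc := grid_avoiding_bound q1 mY Y01 cK' ul lP.
rewrite -(ler_nat R) natrM; apply: (@le_trans _ _ (n%:R * ((size l)%:R * c))).
  rewrite mulrCA ler_peMr// -ler_pdivrMr// mul1r.
  apply: (@le_trans _ _ N%:R); last by rewrite ler_nat.
  by apply/ltW; apply: archi_boundP; rewrite invr_ge0 ltW.
by rewrite ler_wpM2l.
Qed.

(** The prefix is long enough to contain [f k] for every round [k] served by stage [n]. *)
Definition prefix_code (f : nat -> nat) (n : nat) : nat :=
  pickle (mkseq f (2 ^ (4 * n + 4))).

Lemma addN_family_of_game (A : set (nat -> nat)) : gameI_family A ->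
  exists2 F : set (set R), addN_family F & F #<= A.
Proof.
move=> gA; exists [set grid_limsup (prefix_code f) | f in A]; last exact: card_image_le.
split; first by move=> _ [f _ <-]; exact: lnull_grid_limsup.
move=> /slalom_of_lnull[S [sS SP]]; apply: gA.
(* Round [k] is served by the largest stage [n] with [2^(4n) <= k + 1], whose slalom width fits into
   [k + 1]. *)
pose N k := (trunc_log 2 k.+1 %/ 4)%N.
have N4 k : (2 ^ (4 * N k) <= k.+1)%N.
  apply: leq_trans (trunc_logP (isT : (1 < 2)%N) (isT : (0 < k.+1)%N)).
  by rewrite leq_exp2l// mulnC leq_trunc_div.
have kN k : (k < 2 ^ (4 * N k + 4))%N.
  apply: ltn_trans (leq_trans (trunc_log_ltn k.+1 (isT : (1 < 2)%N)) _) => //.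
  by rewrite leq_exp2l// {1}(divn_eq (trunc_log 2 k.+1) 4) mulnC -addnS leq_add2l ltn_mod.
apply: (@slalom_winning _ (fun k =>
  [seq nth 0%N (odflt [::] (unpickle i)) k | i <- S (N k)])).
  move=> k; rewrite size_map (leq_trans (sS _))// (leq_trans _ (N4 k))//.
  exact: width_leq.
move=> f Af; have [|m fm] := SP (prefix_code f).
  by move=> x xf; exists (grid_limsup (prefix_code f)) => //; exists f.
exists (2 ^ (4 * m))%N => k mk; apply/mapP; exists (prefix_code f (N k)).
  apply: fm; rewrite /N leq_divRL// mulnC trunc_log_max// (leq_trans mk)//.
by rewrite /prefix_code pickleK /= nth_mkseq.
Qed.
End slalom_of_null_set.

(* add(N)_game^I = add(N): equality of the two minimal cardinalities, stated as
   mutual domination of the witnessing families. *)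
Theorem mainTheorem9 (R : realType) :
  (forall A : set (nat -> nat), gameI_family A ->
     exists2 F : set (set R), addN_family F & F #<= A) /\
  (forall F : set (set R), addN_family F ->
     exists2 A : set (nat -> nat), gameI_family A & A #<= F).
Proof. by split; [exact: addN_family_of_game|exact: game_family_of_addN]. Qed.
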